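(* Let $s\in(1/2,1)$, $m>1$, and let $H\in C(\mathbb{R}^d\times\mathbb{R}^d)$ satisfy, for some constant $\kappa>0$, $\frac1\kappa|p|^m-\kappa\le H(x,p)\le\kappa(1+|p|^m)$ for all $x,p\in\mathbb{R}^d$. Let $f\in C(\mathbb{R}^d)$ and suppose that for some constants $\kappa_0,\kappa_1>0$ $$f(x)\ge\kappa_0|x|^{m(2s-1)}\quad\text{for }|x|\ge\kappa_1 .$$ Then there exists no pair $(u,\lambda)\in(C(\mathbb{R}^d)\cap L^1(\omega_s))\times\mathbb{R}$ with $u\ge0$ satisfying, in the viscosity sense, $$(-\Delta)^su+H(x,\nabla u)-f+\lambda\ge0\quad\text{in }\mathbb{R}^d .$$ In particular, $\lambda^*:=\inf\{\lambda:\exists\,u\in C(\mathbb{R}^d)\cap L^1(\omega_s),\ u\ge0,\ (-\Delta)^su+H(x,\nabla u)\ge f-\lambda\text{ in }\mathbb{R}^d\}=+\infty$.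
   Context: $L^1(\omega_s)=\{u\in L^1_{loc}(\mathbb{R}^d):\int|u(y)|(1+|y|^{d+2s})^{-1}dy<\infty\}$. $(-\Delta)^su(x)=-c_{d,s}\mathrm{P.V.}\int(u(x+y)-u(x))|y|^{-(d+2s)}dy$, $c_{d,s}=\frac{4^s\Gamma(d/2+s)}{\pi^{d/2}|\Gamma(-s)|}$. The viscosity inequality ''$\ge0$'' means: whenever $\varphi$ is $C^2$ near $\overline{B_\delta(x_0)}$ and $u-\varphi$ has a minimum over $B_\delta(x_0)$ at $x_0$, the inequality holds at $x_0$ with $\nabla u(x_0)$ replaced by $\nabla\varphi(x_0)$ and $(-\Delta)^su(x_0)$ evaluated using $\varphi$ in $B_\delta(x_0)$ and $u$ outside. The infimum of the empty set is $+\infty$. *)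

(* Defs.v *)
From HB Require Import structures.
From mathcomp Require Import all_boot all_order all_algebra.
From mathcomp Require Import all_classical all_reals all_analysis.

Set Implicit Arguments.
Unset Strict Implicit.
Unset Printing Implicit Defensive.

Import Order.TTheory GRing.Theory Num.Theory.
Import numFieldNormedType.Exports.

Local Open Scope classical_set_scope.
Local Open Scope ring_scope.

(* The library has Lebesgue measure on R and binary products only.  The space
   'rV[R]_n gets the product sigma-algebra (generated by the coordinates, hence
   equal to the Borel one), and Lebesgue measure is built by recursion on n. *)

Definition measure_rV_display : measure_display.
Proof. exact: (measure_tuple_display default_measure_display). Qed.

Section measurable_rV.
Context {R : realType} (n : nat).

Let coor : 'I_n -> 'rV[R]_n -> measurableTypeR R := fun i v => v ord0 i.

Let rV_set0 : g_sigma_preimage coor set0.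
Proof. exact: sigma_algebra0. Qed.

Let rV_setC A : g_sigma_preimage coor A -> g_sigma_preimage coor (~` A).
Proof. exact: sigma_algebraC. Qed.

Let rV_bigcup (F : _^nat) : (forall i, g_sigma_preimage coor (F i)) ->
  g_sigma_preimage coor (\bigcup_i (F i)).
Proof. exact: sigma_algebra_bigcup. Qed.

HB.instance Definition _ := @isMeasurable.Build measure_rV_display
  'rV[R]_n (g_sigma_preimage coor) rV_set0 rV_setC rV_bigcup.

End measurable_rV.

Lemma measurable_coord {R : realType} n (i : 'I_n) :
  measurable_fun [set: 'rV[R]_n]
    ((fun v => v ord0 i) : 'rV[R]_n -> measurableTypeR R).
Proof.
move=> _ Y mY; rewrite setTI; apply: sub_sigma_algebra => /=.
rewrite -bigcup_seq/=; exists i => /=; first by rewrite mem_index_enum.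
by exists Y => //; rewrite setTI.
Qed.

Lemma measurable_fun_coordP {R : realType} d (T : measurableType d) n
    (f : T -> 'rV[R]_n) :
  (forall i, measurable_fun [set: T]
    ((fun t => f t ord0 i) : T -> measurableTypeR R)) ->
  measurable_fun [set: T] f.
Proof.
move=> mf _ A mA; rewrite setTI.
suff : [set B | measurable (f @^-1` B)] A by [].
apply: mA => /=; split.
  split => /=.
  - by rewrite preimage_set0; exact: measurable0.
  - by move=> B mB; rewrite setTD preimage_setC; exact: measurableC.
  - by move=> F mF; rewrite preimage_bigcup; exact: bigcup_measurable.
move=> B; rewrite -bigcup_seq/= => -[i _ [C mC <-]].
rewrite !setTI -comp_preimage.
by have := mf i measurableT _ mC; rewrite setTI.
Qed.

Section rV_cons.
Context {R : realType} (n : nat).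

Definition rV_cons (z : measurableTypeR R * 'rV[R]_n) : 'rV[R]_n.+1 :=
  \row_i (if unlift ord0 i is Some j then z.2 ord0 j else z.1).

Definition rV_uncons (v : 'rV[R]_n.+1) : measurableTypeR R * 'rV[R]_n :=
  (v ord0 ord0, \row_j v ord0 (lift ord0 j)).

Lemma rV_consK : cancel rV_cons rV_uncons.
Proof.
move=> [x v]; rewrite /rV_uncons !mxE unlift_none/=; congr pair.
by apply/rowP => j; rewrite !mxE liftK.
Qed.

Lemma measurable_rV_cons : measurable_fun setT rV_cons.
Proof.
apply: measurable_fun_coordP => i.
under eq_fun do rewrite mxE.
case: (unlift ord0 i) => [j|]; last exact: measurable_fst.
exact: measurableT_comp (measurable_coord j) measurable_snd.
Qed.

Lemma measurable_rV_uncons : measurable_fun setT rV_uncons.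
Proof.
apply: measurable_fun_pair; first exact: measurable_coord.
apply: measurable_fun_coordP => i.
under eq_fun do rewrite mxE.
exact: measurable_coord.
Qed.

Variable mu : {sigma_finite_measure set 'rV[R]_n -> \bar R}.

Definition lebesgue_rV_cons : set 'rV[R]_n.+1 -> \bar R :=
  pushforward (@lebesgue_measure R \x mu)%E rV_cons.

Let lebesgue_rV_cons0 : lebesgue_rV_cons set0 = 0%E.
Proof. by rewrite /lebesgue_rV_cons /pushforward preimage_set0 measure0. Qed.

Let lebesgue_rV_cons_ge0 A : (0 <= lebesgue_rV_cons A)%E.
Proof. by rewrite /lebesgue_rV_cons /pushforward; exact: measure_ge0. Qed.

Let lebesgue_rV_cons_sigma_additive : semi_sigma_additive lebesgue_rV_cons.
Proof.
move=> F mF tF mUF; rewrite /lebesgue_rV_cons /pushforward preimage_bigcup.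
have mcons B : measurable B -> measurable (rV_cons @^-1` B).
  by move=> mB; rewrite -[X in measurable X]setTI; exact: measurable_rV_cons.
apply: measure_semi_sigma_additive.
- by move=> k; exact: mcons.
- apply/trivIsetP => /= i j _ _ ij; rewrite -preimage_setI.
  by move/trivIsetP : tF => /(_ _ _ _ _ ij) ->//; rewrite preimage_set0.
- by rewrite -preimage_bigcup; exact: mcons.
Qed.

HB.instance Definition _ := isMeasure.Build _ _ _ lebesgue_rV_cons
  lebesgue_rV_cons0 lebesgue_rV_cons_ge0 lebesgue_rV_cons_sigma_additive.

Let lebesgue_rV_cons_sigma_finite : sigma_finite setT lebesgue_rV_cons.
Proof.
have /sigma_finiteP[F [FT ndF Foo]] := sigma_finiteT (@lebesgue_measure R).
have /sigma_finiteP[G [GT ndG Goo]] := sigma_finiteT mu.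
exists (fun k => rV_uncons @^-1` (F k `*` G k)).
  apply/esym; rewrite -subTset => v _.
  have [i _ Fi] : (\bigcup_k F k) (rV_uncons v).1 by rewrite -FT.
  have [j _ Gj] : (\bigcup_k G k) (rV_uncons v).2 by rewrite -GT.
  exists (maxn i j) => //; split.
  - by move: Fi; exact/subsetPset/ndF/leq_maxl.
  - by move: Gj; exact/subsetPset/ndG/leq_maxr.
move=> k; have [mF Fkoo] := Foo k; have [mG Gkoo] := Goo k; split.
  rewrite -[X in measurable X]setTI.
  by apply: measurable_rV_uncons => //; exact: measurableX.
rewrite /= /lebesgue_rV_cons /pushforward -comp_preimage.
rewrite (_ : _ \o _ = id); last by apply/funext; exact: rV_consK.
by rewrite preimage_id product_measure1E// lte_mul_pinfty// ge0_fin_numE.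
Qed.

HB.instance Definition _ := Measure_isSigmaFinite.Build _ _ _ lebesgue_rV_cons
  lebesgue_rV_cons_sigma_finite.

End rV_cons.

Fixpoint lebesgue_rV (R : realType) (n : nat) :
    {sigma_finite_measure set 'rV[R]_n -> \bar R} :=
  match n with
  | 0 => \d_(0 : 'rV[R]_0)
  | k.+1 => lebesgue_rV_cons (lebesgue_rV R k)
  end.

Lemma lebesgue_rV_box (R : realType) (n : nat)
    (A : 'I_n -> set (measurableTypeR R)) : (forall i, measurable (A i)) ->
  (lebesgue_rV R n [set v | forall i, A i (v ord0 i)] =
   \prod_(i < n) (@lebesgue_measure R (A i)))%E.
Proof.
elim: n A => [A _|n IH A mA].
  by rewrite big_ord0 /= diracE mem_set// => -[].
pose B : set 'rV[R]_n := [set v | forall i, A (lift ord0 i) (v ord0 i)].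
have mB : measurable B.
  have -> : B = \bigcap_(i in [set: 'I_n])
      ((fun v : 'rV[R]_n => v ord0 i) @^-1` A (lift ord0 i)).
    by apply/seteqP; split => v /= Bv i; [move=> _|]; exact: Bv.
  apply: fin_bigcap_measurable => // i _.
  rewrite -[X in measurable X]setTI.
  exact: (@measurable_coord R n i measurableT _ (mA _)).
rewrite big_ord_recl -IH; last by move=> i; exact: mA.
rewrite -/B -product_measure1E// /= /lebesgue_rV_cons /pushforward.
congr (_ _); apply/seteqP; split => -[x v] /=.
  move=> H; split => /=; first by have := H ord0; rewrite mxE unlift_none.
  by move=> i; have := H (lift ord0 i); rewrite mxE liftK.
move=> [/= Hx Hv] i; rewrite mxE.
by case: unliftP => [j ->|->]; [exact: Hv|exact: Hx].
Qed.

(* The library norm `|x| on 'rV[R]_n is the sup norm; it induces the same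
   topology, whereas the growth conditions and balls use the
   Euclidean norm. *)
Definition enorm (R : realType) (n : nat) (x : 'rV[R]_n) : R :=
  Num.sqrt (\sum_(i < n) x ord0 i ^+ 2).

Definition eball (R : realType) (n : nat) (x : 'rV[R]_n) (r : R) :
    set 'rV[R]_n :=
  [set y | enorm (y - x) < r].

Definition closed_eball (R : realType) (n : nat) (x : 'rV[R]_n) (r : R) :
    set 'rV[R]_n :=
  [set y | enorm (y - x) <= r].

Definition partial (R : realType) (n : nat) (i : 'I_n) (f : 'rV[R]_n -> R)
    (x : 'rV[R]_n) : R :=
  'D_(delta_mx ord0 i) f x.

Definition grad (R : realType) (n : nat) (f : 'rV[R]_n -> R) (x : 'rV[R]_n) :
    'rV[R]_n :=
  \row_i partial i f x.

(* Only meaningful for open U. *)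
Fixpoint Cn_on (R : realType) (n k : nat) (U : set 'rV[R]_n)
    (f : 'rV[R]_n -> R) : Prop :=
  (forall x, U x -> {for x, continuous f}) /\
  (if k is k'.+1 then
     forall i : 'I_n,
       (forall x, U x -> derivable f x (delta_mx ord0 i)) /\
       Cn_on k' U (partial i f)
   else True).

Definition C2_near (R : realType) (n : nat) (K : set 'rV[R]_n)
    (f : 'rV[R]_n -> R) : Prop :=
  exists U : set 'rV[R]_n, [/\ open U, K `<=` U & Cn_on 2 U f].

Definition Gamma_pos (R : realType) (x : R) : R :=
  \int[@lebesgue_measure R]_(t in `]0, +oo[) (t `^ (x - 1) * expR (- t)).

(* For x <= 0, the extension by Gamma (x + 1) = x * Gamma x, iterated up to
   0 < x + n <= 1; at the poles the value is 0. *)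
Definition Gamma (R : realType) (x : R) : R :=
  if 0 < x then Gamma_pos x
  else let n := (Num.truncn (- x)).+1 in
       Gamma_pos (x + n%:R) / \prod_(i < n) (x + i%:R).

Definition L1_loc (R : realType) (d : nat) (u : 'rV[R]_d -> R) : Prop :=
  forall K : set 'rV[R]_d, compact K ->
    (lebesgue_rV R d).-integrable K (EFin \o u).

Definition L1_omega (R : realType) (d : nat) (s : R) (u : 'rV[R]_d -> R) :
    Prop :=
  L1_loc u /\
  (\int[lebesgue_rV R d]_y
     (`|u y| * (1 + enorm y `^ (d%:R + 2 * s))^-1)%:E < +oo)%E.

Definition frac_const (R : realType) (d : nat) (s : R) : R :=
  4 `^ s * Gamma (d%:R / 2 + s) / (pi `^ (d%:R / 2) * `|Gamma (- s)|).

Definition frac_laplacian (R : realType) (d : nat) (s : R)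
    (u : 'rV[R]_d -> R) (x : 'rV[R]_d) : R :=
  - frac_const d s *
  lim ((\int[lebesgue_rV R d]_(y in [set y | (e < enorm y)%R])
          ((u (x + y) - u x) * enorm y `^ (- (d%:R + 2 * s)))) @[e --> 0^'+]).

(* phi in the ball and u outside.  Each function is normalized by its value at
   the centre, so that the increments entering the fractional Laplacian at x0
   are phi y - phi x0 inside the ball and u y - u x0 outside, i.e. the result
   does not change when a constant is added to phi. *)
Definition glue (R : realType) (d : nat) (u phi : 'rV[R]_d -> R)
    (x0 : 'rV[R]_d) (delta : R) (y : 'rV[R]_d) : R :=
  if enorm (y - x0) < delta then phi y - phi x0 else u y - u x0.

Definition viscosity_supersolution (R : realType) (d : nat) (s : R)
    (H : 'rV[R]_d * 'rV[R]_d -> R) (f : 'rV[R]_d -> R)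
    (u : 'rV[R]_d -> R) (lambda : R) : Prop :=
  forall (x0 : 'rV[R]_d) (delta : R) (phi : 'rV[R]_d -> R),
    0 < delta ->
    C2_near (closed_eball x0 delta) phi ->
    (forall y, eball x0 delta y -> u x0 - phi x0 <= u y - phi y) ->
    0 <= frac_laplacian s (glue u phi x0 delta) x0 + H (x0, grad phi x0)
         - f x0 + lambda.

Definition admissible (R : realType) (d : nat) (s : R)
    (H : 'rV[R]_d * 'rV[R]_d -> R) (f : 'rV[R]_d -> R)
    (u : 'rV[R]_d -> R) (lambda : R) : Prop :=
  [/\ continuous u, L1_omega s u, (forall x, 0 <= u x)
    & viscosity_supersolution s H f u lambda].

Definition lambda_star (R : realType) (d : nat) (s : R)
    (H : 'rV[R]_d * 'rV[R]_d -> R) (f : 'rV[R]_d -> R) : \bar R :=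
  ereal_inf [set lambda%:E | lambda in
    [set lambda | exists u, admissible s H f u lambda]].

(* Main.v *)
Require Import Defs.
From mathcomp Require Import all_boot all_order all_algebra.
From mathcomp Require Import all_classical all_reals all_analysis.
From mathcomp Require Import measurable_realfun lra ring.
Import Order.TTheory GRing.Theory Num.Theory.
Import numFieldNormedType.Exports.
Local Open Scope classical_set_scope.
Local Open Scope ring_scope.

(** A nonnegative supersolution is forced to grow at least like [|x|^(2s)], and
    such growth is exactly the borderline that the weight
    [(1 + |y|^(d+2s))^-1] cannot integrate.

    Lower growth ([supersolution_lower_growth]).  Fix [z] far away, put
    [r = |z|/2] and compare [u] with the concave paraboloid
    [phi y = M - M |y - z|^2 / r^2], where [M = c r^(2s)].  If [u z < M], then
    [u - phi] has a negative global minimum at some [x] in the ball of radius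
    [r] about [z], because [phi <= 0 <= u] outside that ball
    ([paraboloid_touches]).  At [x], testing with [phi] on the unit ball
    around [x],
    - the gradient of [phi] has size at most [2M/r = 2 c t], with
      [t = r^(2s-1)], so the Hamiltonian is at most
      [kappa (1 + 2^m c^m t^m)];
    - the fractional Laplacian is at most [C (1 + 3 c t)]
      ([frac_laplacian_le]);
    - [|x| >= r], so [f x >= kappa0 t^m].
    Since [m >= 1], for [c] small the terms carrying [c] are absorbed by half
    of [kappa0 t^m], and the remaining constants are beaten once [t] is large.
    Hence [u z >= c r^(2s)].

    The bound on the fractional Laplacian splits the increments of the test
    function at [x] as [p . y] on the unit ball, which integrates to zero
    against the even kernel ([Rintegral_odd], through the invariance
    [lebesgue_rVN] of Lebesgue measure under [y |-> - y]), plus an error of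
    size [a min(|y|^2, |y|)].  Against the kernel [|y|^-(d+2s)] the error is
    integrable because [1 < 2s < 2] ([levy_weight_integral_lty]).  Only
    one-sided bounds on the increments are at hand, and they suffice:
    if the principal value does not converge, or if an integral is [+oo], the
    total operators [lim] and [fine] return a fixed default value, which is
    absorbed in [C].

    Contradiction ([weighted_integral_infinite]).  On each of the disjoint
    boxes [[2^k, 2^(k+1))^d] the integral of [u (1 + |y|^(d+2s))^-1] is
    bounded below by one and the same positive constant. *)

(** * Euclidean norm and scalar product *)

Section euclidean.
Context {R : realType} {d : nat}.
Implicit Types (x y z : 'rV[R]_d).

Definition edot x y : R := \sum_(i < d) x ord0 i * y ord0 i.

Lemma enorm_ge0 x : 0 <= enorm x.
Proof. exact: sqrtr_ge0. Qed.

Lemma enorm_sqr x : enorm x ^+ 2 = edot x x.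
Proof.
rewrite /enorm sqr_sqrtr; last by apply: sumr_ge0 => i _; exact: sqr_ge0.
by apply: eq_bigr => i _; rewrite expr2.
Qed.

Lemma enormN x : enorm (- x) = enorm x.
Proof. by congr Num.sqrt; apply: eq_bigr => i _; rewrite mxE sqrrN. Qed.

Lemma edotNr x y : edot x (- y) = - edot x y.
Proof. by rewrite -sumrN; apply: eq_bigr => i _; rewrite mxE mulrN. Qed.

Lemma enorm0 : enorm (0 : 'rV[R]_d) = 0.
Proof.
by rewrite /enorm big1 ?sqrtr0// => i _; rewrite mxE expr0n.
Qed.

Lemma coord_le_enorm x i : `|x ord0 i| <= enorm x.
Proof.
rewrite -sqrtr_sqr ler_wsqrtr// (bigD1 i)//= lerDl sumr_ge0// => j _.
exact: sqr_ge0.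
Qed.

Lemma enormZ (a : R) x : enorm (a *: x) = `|a| * enorm x.
Proof.
rewrite /enorm; under eq_bigr do rewrite mxE exprMn.
by rewrite -mulr_sumr sqrtrM ?sqr_ge0// sqrtr_sqr.
Qed.

Lemma enorm_sqrD x y :
  enorm (x + y) ^+ 2 = enorm x ^+ 2 + 2 * edot x y + enorm y ^+ 2.
Proof.
rewrite !enorm_sqr /edot mulr_sumr -!big_split/=.
by apply: eq_bigr => i _; rewrite mxE; ring.
Qed.

Lemma edot_le x y : edot x y <= enorm x * enorm y.
Proof.
have xy0 : 0 <= enorm x * enorm y by rewrite mulr_ge0 ?enorm_ge0.
have [xy|xy] := eqVneq (enorm x * enorm y) 0.
  suff -> : edot x y = 0 by rewrite xy.
  apply: big1 => i _; apply/eqP; rewrite mulf_eq0; apply/orP.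
  move: xy => /eqP; rewrite mulf_eq0 => /orP[]/eqP e.
    by left; rewrite -normr_le0 -e coord_le_enorm.
  by right; rewrite -normr_le0 -e coord_le_enorm.
have {}xy0 : 0 < enorm x * enorm y by rewrite lt_neqAle eq_sym xy.
have : 0 <= enorm (enorm y *: x + (- enorm x) *: y) ^+ 2 by exact: sqr_ge0.
rewrite enorm_sqrD !enormZ normrN !ger0_norm ?enorm_ge0//.
have -> : edot (enorm y *: x) (- enorm x *: y) =
          - (enorm x * enorm y) * edot x y.
  by rewrite /edot mulr_sumr; apply: eq_bigr => i _; rewrite !mxE; ring.
nra.
Qed.

Lemma enormD x y : enorm (x + y) <= enorm x + enorm y.
Proof.
rewrite -(@ler_pXn2r _ 2)// ?nnegrE ?addr_ge0 ?enorm_ge0//.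
rewrite enorm_sqrD sqrrD; have := edot_le x y; lra.
Qed.

Lemma enorm_le_sum x : enorm x <= \sum_(i < d) `|x ord0 i|.
Proof.
have h0 : 0 <= \sum_(i < d) `|x ord0 i| by apply: sumr_ge0.
rewrite -(@ler_pXn2r _ 2)// ?nnegrE ?enorm_ge0// enorm_sqr expr2 mulr_suml.
apply: ler_sum => i _; rewrite -expr2 -real_normK ?num_real// expr2.
by rewrite ler_wpM2l// (bigD1 i)//= lerDl sumr_ge0.
Qed.

Lemma enorm_continuous : continuous (@enorm R d).
Proof.
move=> x; apply: (@continuous_comp _ _ _ _ (@Num.sqrt R));
  last exact: sqrt_continuous.
apply: continuous_big => [|i _]; first exact: add_continuous.
move=> v; apply: (@continuous_comp _ _ _ (fun v : 'rV[R]_d => v ord0 i)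
  (fun t : R => t ^+ 2)); [exact: coord_continuous|exact: exprn_continuous].
Qed.

End euclidean.

(** * Borel sets of row vectors and reflection invariance *)

Section measurability.
Context {R : realType} {d : nat}.

Lemma measurable_rV_box (A : 'I_d -> set (measurableTypeR R)) :
  (forall i, measurable (A i)) ->
  measurable [set v : 'rV[R]_d | forall i, A i (v ord0 i)].
Proof.
move=> mA.
have -> : [set v : 'rV[R]_d | forall i, A i (v ord0 i)] =
    \bigcap_(i in [set: 'I_d]) ((fun v : 'rV[R]_d => v ord0 i) @^-1` A i).
  by apply/seteqP; split => v /= Bv i; [move=> _|]; exact: Bv.
apply: fin_bigcap_measurable => // i _.
rewrite -[X in measurable X]setTI.
exact: (@measurable_coord R d i measurableT _ (mA _)).
Qed.

(** The sigma-algebra on row vectors is generated by the coordinates; it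
    contains the open sets because each of them is the union of the countably
    many rational cubes that it contains. *)
Lemma open_measurable_rV (U : set 'rV[R]_d) : open U -> measurable U.
Proof.
move=> oU.
pose B (qn : 'rV[rat]_d * nat) : set 'rV[R]_d := [set v | forall i,
  `]ratr (qn.1 ord0 i) - (qn.2.+1%:R)^-1,
    ratr (qn.1 ord0 i) + (qn.2.+1%:R)^-1[%classic (v ord0 i)].
have mB qn : measurable (B qn).
  rewrite /B; apply: (@measurable_rV_box (fun i =>
    `]ratr (qn.1 ord0 i) - (qn.2.+1%:R)^-1,
      ratr (qn.1 ord0 i) + (qn.2.+1%:R)^-1[%classic)) => i.
  exact: measurable_itv.
pose F qn := if `[< B qn `<=` U >] then B qn else set0.
have -> : U = \bigcup_qn F qn.
  apply/seteqP; split => [x Ux|x [qn _]]; last first.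
    by rewrite /F; case: asboolP => // /[apply].
  have /nbhs_ballP[e /= e0 eU] : nbhs x U by exact: open_nbhs_nbhs.
  (* a cube of half-side h centred within h of x stays in the ball of radius
     2 h around x, hence the factor 2 *)
  have [n ne] : exists n : nat, 2 * (n.+1%:R)^-1 < e.
    exists (Num.truncn (2 / e)); rewrite ltr_pdivrMr// mulrC -ltr_pdivrMr//.
    exact: truncnS_gt.
  have n0 : 0 < (n.+1%:R : R)^-1 by rewrite invr_gt0.
  have [h hE] : exists h : R, h = (n.+1%:R)^-1 by exists (n.+1%:R)^-1.
  rewrite -hE in ne n0.
  have qP i : exists q : rat,
      x ord0 i - h < ratr q < x ord0 i + h.
    have /rat_in_itvoo[q] : x ord0 i - h < x ord0 i + h.
      by lra.
    by rewrite in_itv/= => xq; exists q.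
  have [q qx] := choice qP.
  pose r : 'rV[rat]_d := \row_i q i.
  exists (r, n) => //; rewrite /F.
  case: asboolP => [_ i|[]].
    rewrite mxE /mkset -hE in_itv/=; have /andP[*] := qx i.
    by apply/andP; split; lra.
  move=> v Bv; apply: eU; split => // i j; rewrite (ord1 i); move: (Bv j).
  rewrite mxE /mkset -hE in_itv/= => /andP[? ?]; have /andP[? ?] := qx j.
  by rewrite /ball/= ltr_norml; apply/andP; split; lra.
apply: countable_bigcupT_measurable => [|qn]; first exact: countableP.
by rewrite /F; case: asboolP.
Qed.

Lemma continuous_measurable_rV (f : 'rV[R]_d -> R) :
  continuous f -> measurable_fun setT f.
Proof.
move=> cf.
apply: (measurability _ (RGenOpens.measurableE R)) => _ [_ [a [b ->] <-]].
rewrite setTI; apply: open_measurable_rV.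
by apply: open_comp => // x _; exact: cf.
Qed.

Lemma measurable_enorm :
  measurable_fun setT (@enorm R d).
Proof. apply: continuous_measurable_rV; exact: enorm_continuous. Qed.

Lemma measurable_oppr_rV : measurable_fun setT (-%R : 'rV[R]_d -> 'rV[R]_d).
Proof.
apply: measurable_fun_coordP => i; under eq_fun do rewrite mxE.
by apply: measurable_funN; exact: measurable_coord.
Qed.

End measurability.

(** Lebesgue measure is a product built by recursion, so the invariance on the
    line propagates: the image of the product under reflection agrees with the
    product on rectangles. *)
Lemma lebesgue_rVN {R : realType} (d : nat) (A : set 'rV[R]_d) :
  measurable A ->
  pushforward (lebesgue_rV R d) (-%R : 'rV[R]_d -> 'rV[R]_d) A =
  lebesgue_rV R d A.
Proof.
elim: d A => [|d IH] A mA.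
  by rewrite /pushforward/= !diracE (_ : _ @^-1` A = A)//;
    apply/seteqP; split => x /=; rewrite (thinmx0 x) oppr0.
pose neg (z : measurableTypeR R * 'rV[R]_d) : measurableTypeR R * 'rV[R]_d :=
  (- z.1, - z.2).
have mneg : measurable_fun setT neg.
  apply: measurable_fun_pair.
    exact: (measurableT_comp (@oppr_measurable R setT) measurable_fst).
  exact: (measurableT_comp measurable_oppr_rV measurable_snd).
have consN : @rV_cons R d \o neg = -%R \o @rV_cons R d.
  apply/funext => -[x v]; apply/rowP => i; rewrite /= !mxE.
  by case: unliftP => [j _|_] //=; rewrite mxE.
have mcons B : measurable B -> measurable (@rV_cons R d @^-1` B).
  by move=> mB; rewrite -[X in measurable X]setTI; exact: measurable_rV_cons.
have mN B : measurable B -> measurable ((-%R : 'rV[R]_d -> 'rV[R]_d) @^-1` B).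
  by move=> mB; rewrite -[X in measurable X]setTI; exact: measurable_oppr_rV.
rewrite /pushforward /= /lebesgue_rV_cons /pushforward -comp_preimage -consN.
rewrite comp_preimage.
pose nu : {measure set _ -> \bar R} :=
  measure_function_pushforward__canonical__measure_function_Measure
    (@lebesgue_measure R \x lebesgue_rV R d)%E mneg.
apply/esym/(@product_measure_unique _ _ _ _ R _ _ nu); last exact: mcons.
move=> B C mB mC; rewrite /nu /= /pushforward.
have -> : neg @^-1` (B `*` C) = (-%R @^-1` B) `*` (-%R @^-1` C) by [].
rewrite product_measure1E//; last 2 first.
- by rewrite -[X in measurable X]setTI; exact: oppr_measurable.
- exact: mN.
by rewrite -(lebesgue_measureN mB) -(IH _ mC).
Qed.

(** * Integrability of powers of the norm over dyadic shells *)

Lemma dyadic_bracket {R : realType} (x : R) : 1 <= x ->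
  exists k : nat, 2 ^+ k <= x <= 2 * 2 ^+ k.
Proof.
move=> x1; have /andP[t1 t2] := truncn_itv (le_trans ler01 x1).
have t0 : (0 < Num.truncn x)%N 
  by move: t2; rewrite lt0n; case: (Num.truncn x) => //; lra.
exists (trunc_log 2 (Num.truncn x)); apply/andP; split.
  rewrite -natrX; apply: le_trans t1; rewrite ler_nat; exact: trunc_logP.
rewrite -natrX -natrM -expnS; apply: le_trans (ltW t2) _.
by rewrite ler_nat trunc_log_ltn.
Qed.

Section dyadic.
Context {R : realType} {d : nat}.
Let mu := lebesgue_rV R d.

Definition cube (a b : R) : set 'rV[R]_d :=
  [set v | forall i, `[a, b]%classic (v ord0 i)].

Lemma measurable_cube (a b : R) : measurable (cube a b).
Proof. by apply: (@measurable_rV_box _ _ (fun=> `[a, b]%classic)). Qed.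

Lemma lebesgue_rV_cube (a b : R) : a <= b -> mu (cube a b) = ((b - a) ^+ d)%:E.
Proof.
move=> ab; rewrite /mu (@lebesgue_rV_box R d (fun=> `[a, b]%classic))//.
have -> : lebesgue_measure `[a, b]%classic = (b - a)%:E.
  rewrite lebesgue_measure_itv/= lte_fin.
  move: ab; rewrite le_eqVlt => /orP[/eqP ->|ab].
    by rewrite ltxx subrr.
  by rewrite ab EFinB.
by rewrite prodEFin prodr_const card_ord.
Qed.

(** On the shell [tau <= |y| <= 2 tau] the integrand [|y|^(e-d)] is at most
    [tau^(e-d)], and the shell lies in a cube of volume [(4 tau)^d]; its
    contribution is therefore at most [4^d tau^e].  If these quantities decay
    geometrically, the union of the shells contributes a finite amount.  With
    [tau] a power of [1/2] and [e > 0] this gives integrability near the origin,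
    with [tau] a power of [2] and [e < 0] integrability at infinity. *)
Lemma integral_shells_lty (A : set 'rV[R]_d) (e : R) (tau : nat -> R)
    (c z : R) :
  measurable A -> e <= d%:R -> (forall k, 0 < tau k) ->
  0 <= c -> 0 < z < 1 -> (forall k, tau k `^ e <= c * z ^+ k) ->
  (forall y, A y -> exists k, tau k <= enorm y <= 2 * tau k) ->
  (\int[mu]_(y in A) (enorm y `^ (e - d%:R))%:E < +oo)%E.
Proof.
move=> mA ed tau0 c0 /andP[z0 z1] tauE Atau.
pose a k := tau k `^ (e - d%:R).
pose B k := cube (- (2 * tau k)) (2 * tau k).
have a0 k : 0 <= a k by exact: powR_ge0.
have mB k : measurable (B k) by exact: measurable_cube.
have mf k : measurable_fun A (fun y => (a k * \1_(B k) y)%:E).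
  by apply/measurable_EFinP; apply: measurable_funM.
(* the term of one shell containing y already dominates the integrand *)
apply: (@le_lt_trans _ _
    (\int[mu]_(y in A) (\sum_(0 <= k <oo) (a k * \1_(B k) y)%:E))%E).
  apply: ge0_le_integral => //.
  - by move=> y _; rewrite lee_fin powR_ge0.
  - apply/measurable_EFinP/measurable_funTS.
    apply: (measurableT_comp (measurable_powR _)).
    exact: measurable_enorm.
  - apply: ge0_emeasurable_sum => // k y _ _.
    by rewrite lee_fin mulr_ge0.
  - move=> y Ay; have [k /andP[k1 k2]] := Atau y Ay.
    apply: (@le_trans _ _ (a k * \1_(B k) y)%:E).
      rewrite lee_fin indicE mem_set; last first.
        move=> i; rewrite /= in_itv/= -ler_norml.
        exact: le_trans (coord_le_enorm _ _) k2.
      rewrite mulr1 /a -(opprK (e - _)) powRN (powRN (tau k)).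
      rewrite lef_pV2 ?posrE ?powR_gt0//; last exact: lt_le_trans (tau0 k) k1.
      apply: ge0_ler_powR => //; rewrite ?nnegrE ?enorm_ge0//.
        by rewrite opprB subr_ge0.
      exact/ltW.
    pose g k := (a k * \1_(B k) y)%:E.
    have g0 j : (0 <= g j)%E by rewrite lee_fin mulr_ge0.
    apply: le_trans (nneseries_lim_ge k.+1 _) => //.
      by rewrite big_nat_recr//= leeDr//; apply: sume_ge0 => j _; exact: g0.
    by move=> j _ _; exact: g0.
rewrite integral_nneseries//; last by move=> k y _; rewrite lee_fin mulr_ge0.
apply: (@le_lt_trans _ _ (\sum_(0 <= k <oo) (4 ^+ d * c * z ^+ k)%:E)%E).
  apply: lee_nneseries => k.
    by move=> *; apply: integral_ge0 => y _; rewrite lee_fin mulr_ge0.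
  move=> _; under eq_integral do rewrite EFinM.
  rewrite ge0_integralZl_EFin//; last exact/measurable_EFinP.
  rewrite integral_indic//.
  apply: (@le_trans _ _ ((a k)%:E * mu (B k))%E).
    by rewrite lee_wpmul2l ?lee_fin// le_measure ?inE//; exact: measurableI.
  rewrite lebesgue_rV_cube; last by have := tau0 k; lra.
  rewrite opprK -EFinM lee_fin /a powRB; last first.
    by apply/implyP => _; rewrite gt_eqF.
  rewrite powR_mulrn; last exact: ltW.
  have -> : 2 * tau k + 2 * tau k = 4 * tau k by ring.
  rewrite exprMn mulrCA divfK ?expf_neq0 ?gt_eqF//.
  by rewrite -mulrA ler_wpM2l ?exprn_ge0.
pose w n := series (geometric (4 ^+ d * c) z) n.
have w_le n : w n <= 4 ^+ d * c / (1 - z).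
  rewrite /w; apply: geometric_le_lim => //; last by rewrite gtr0_norm.
  by rewrite mulr_ge0// exprn_ge0.
apply: (@le_lt_trans _ _ (4 ^+ d * c / (1 - z))%:E); last exact: ltry.
apply: lime_le.
  by apply: is_cvg_nneseries => k _ _; rewrite lee_fin; apply: mulr_ge0;
    [rewrite mulr_ge0// exprn_ge0|exact/exprn_ge0/ltW].
by near=> n; rewrite /= sumEFin lee_fin; exact: w_le.
Unshelve. all: by end_near. Qed.

End dyadic.

(** * The weight controlling increments of a test function *)

Lemma powR_exprn {R : realType} (a e : R) n :
  0 <= a -> (a ^+ n) `^ e = (a `^ e) ^+ n.
Proof.
by move=> a0; rewrite -!powR_mulrn ?powR_ge0// -!powRrM mulrC.
Qed.

Lemma half_powR_lt1 {R : realType} (e : R) : 0 < e -> 2^-1 `^ e < 1.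
Proof.
move=> e0; have := @gt0_ltr_powR R e e0 2^-1 1.
by rewrite powR1; apply; rewrite ?nnegrE; lra.
Qed.

Section weight.
Context {R : realType} {d : nat}.
Let mu := lebesgue_rV R d.

(** The kernel [|y|^-(d+2s)] times the size of the increments that has to be
    controlled: quadratic near the origin, where the linear part cancels by
    symmetry, and linear far away.  The linear rate at infinity, rather than
    the supremum of the test function, is what makes the bound scale like the
    gradient. *)
Definition levy_weight (s : R) (y : 'rV[R]_d) : R :=
  Num.min (enorm y ^+ 2) (enorm y) * enorm y `^ (- (d%:R + 2 * s)).

Lemma measurable_enorm_powR (e : R) :
  measurable_fun setT (fun y : 'rV[R]_d => enorm y `^ e).
Proof. exact: (measurableT_comp (measurable_powR _) measurable_enorm). Qed.

Lemma measurable_levy_weight (s : R) : measurable_fun setT (levy_weight s).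
Proof.
apply: measurable_funM; last exact: measurable_enorm_powR.
apply: measurable_minr; last exact: measurable_enorm.
by apply: measurable_funX; exact: measurable_enorm.
Qed.

Lemma levy_weight_ge0 s y : 0 <= levy_weight s y.
Proof.
by rewrite mulr_ge0 ?powR_ge0// le_min exprn_ge0 enorm_ge0.
Qed.

Lemma measurable_enorm_gt (r : R) : measurable [set y : 'rV[R]_d | r < enorm y].
Proof.
rewrite -[X in measurable X]setTI.
rewrite (_ : [set y | _] = (@enorm R d) @^-1` `]r, +oo[); last first.
  by apply/seteqP; split => y /=; rewrite in_itv/= andbT.
exact: measurable_enorm.
Qed.

Lemma measurable_enorm_ge (r : R) : measurable [set y : 'rV[R]_d | r <= enorm y].
Proof.
rewrite -[X in measurable X]setTI.
rewrite (_ : [set y | _] = (@enorm R d) @^-1` `[r, +oo[); last first.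
  by apply/seteqP; split => y /=; rewrite in_itv/= andbT.
exact: measurable_enorm.
Qed.

(** The power of the norm is [(2-2s) - d] inside the unit ball and [(1-2s) - d]
    outside: [s < 1] gives convergence at the origin and [1/2 < s] at infinity.
*)
Lemma levy_weight_integral_lty (s : R) : (0 < d)%N -> 1 / 2 < s < 1 ->
  (\int[mu]_(y in [set y | (0 < enorm y)%R]) (levy_weight s y)%:E < +oo)%E.
Proof.
move=> d0 /andP[s1 s2].
have d1 : 1 <= d%:R :> R by rewrite ler1n.
have mge := @measurable_enorm_ge 1.
have mgt := @measurable_enorm_gt 0.
have mlt : measurable
    ([set y : 'rV[R]_d | 0 < enorm y] `\` [set y | 1 <= enorm y]).
  exact: measurableD.
have -> : [set y : 'rV[R]_d | 0 < enorm y] =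
    ([set y : 'rV[R]_d | 0 < enorm y] `\` [set y | 1 <= enorm y]) `|`
    [set y | 1 <= enorm y].
  by rewrite setUC setDUK// => y /=; exact: lt_le_trans.
rewrite ge0_integral_setU//=; last 3 first.
- by apply/measurable_EFinP/measurable_funTS; exact: measurable_levy_weight.
- by move=> y _; rewrite lee_fin levy_weight_ge0.
- by apply/disj_setPS => y [[_ +] ?]; exact.
rewrite lte_add_pinfty//.
- under eq_integral => y.
    rewrite inE/= => -[y0 /negP]; rewrite -ltNge => y1.
    rewrite /levy_weight (_ : Num.min _ _ = enorm y ^+ 2); last first.
      by apply/min_idPl; rewrite expr2 ger_pMr ?ltW.
    rewrite -powR_mulrn ?enorm_ge0// -powRD; last by rewrite (gt_eqF y0) implybT.
    rewrite (_ : 2%:R - _ = (2 - 2 * s) - d%:R); last by ring.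
    over.
  apply: (@integral_shells_lty _ _ _ _ (fun k => 2^-1 ^+ k.+1) 1
    (2^-1 `^ (2 - 2 * s))) => //.
  + by lra.
  + by rewrite powR_gt0//= half_powR_lt1//; lra.
  + move=> k; rewrite mul1r powR_exprn; last by lra.
    rewrite exprS. rewrite ler_piMl ?exprn_ge0 ?powR_ge0//.
    by rewrite ltW// half_powR_lt1//; lra.
  + move=> y [/= y0 /negP]; rewrite -ltNge => y1.
    have [|k /andP[k1 k2]] := @dyadic_bracket _ (enorm y)^-1.
      by rewrite invf_ge1// ltW.
    exists k; rewrite exprS mulrA exprVn mulfV// mul1r.
    apply/andP; split.
      by rewrite -invfM -[leRHS]invrK lef_pV2// posrE ?invr_gt0// mulr_gt0.
    by rewrite -[leLHS]invrK lef_pV2// posrE ?invr_gt0.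
- under eq_integral => y.
    rewrite inE/= => y1; have y0 := lt_le_trans ltr01 y1.
    rewrite /levy_weight (_ : Num.min _ _ = enorm y); last first.
      by apply/min_idPr; rewrite expr2 ler_pMr.
    rewrite -{1}[enorm y]powRr1 ?enorm_ge0// -powRD;
      last by rewrite (gt_eqF y0) implybT.
    rewrite (_ : 1 - _ = (1 - 2 * s) - d%:R); last by ring.
    over.
  apply: (@integral_shells_lty _ _ _ _ (fun k => 2 ^+ k) 1
    (2 `^ (1 - 2 * s))) => //.
  + by lra.
  + rewrite powR_gt0//= -opprB powRN -powR_inv1 ?powR_ge0//.
    rewrite -powRAC powR_inv1// half_powR_lt1//; lra.
  + by move=> k; rewrite mul1r powR_exprn.
  + by move=> y /= /dyadic_bracket.
Qed.

End weight.

Section Rintegral_below.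
Context {disp : measure_display} {T : measurableType disp} {R : realType}.
Variable mu : {measure set T -> \bar R}.

(** If [F] is not integrable, the minorant still bounds its negative part, so
    the integral is [+oo] and its real value is the default [0]; the assumption
    [b <= 0] covers this case. *)
Lemma Rintegral_ge_of_integrable_minorant (D : set T) (h F : T -> R) (b : R) :
  measurable D -> measurable_fun D F ->
  mu.-integrable D (EFin \o h) -> (forall y, D y -> h y <= F y) ->
  b <= 0 -> b <= \int[mu]_(y in D) h y -> b <= \int[mu]_(y in D) F y.
Proof.
move=> mD mF ih hF b0 bh.
have [iF|niF] := pselect (mu.-integrable D (EFin \o F)).
  by apply: le_trans bh _; exact: le_Rintegral.
have mEF : measurable_fun D (EFin \o F) by exact/measurable_EFinP.
have neg_fin : (\int[mu]_(y in D) (EFin \o F)^\- y < +oo)%E.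
  apply: (le_lt_trans _ (integral_funeneg_lt_pinfty mD ih)).
  apply: ge0_le_integral => //.
  - exact: measurable_funeneg.
  - by apply: measurable_funeneg; exact: measurable_int ih.
  - move=> y Dy; rewrite !funenegE/= -!EFin_max lee_fin.
    by rewrite ge_max !le_max lerN2 hF// lexx orbT.
suff : (\int[mu]_(y in D) (F y)%:E = +oo)%E by rewrite /Rintegral => ->.
have neg0 : (0 <= \int[mu]_(y in D) (EFin \o F)^\- y)%E.
  exact: integral_ge0.
suff posE : (\int[mu]_(y in D) (EFin \o F)^\+ y = +oo)%E.
  rewrite integralE posE addye//; apply/eqP => /eqP.
  by rewrite eqe_oppLR/= => /eqP e; rewrite e in neg_fin.
apply/eqP; rewrite -leye_eq leNgt; apply/negP => pos_fin.
apply: niF; apply/integrableP; split => //.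
rewrite (eq_integral ((EFin \o F)^\+ \+ (EFin \o F)^\-)%E); last first.
  by move=> y _; exact: (congr1 (fun g => g y) (fune_abse (EFin \o F))).
rewrite ge0_integralD//; last 2 first.
- exact: measurable_funepos.
- exact: measurable_funeneg.
exact: lte_add_pinfty.
Qed.

End Rintegral_below.

(** * One-sided bound for the fractional Laplacian *)

Section frac_laplacian_bound.
Context {R : realType} {d : nat}.
Let mu := lebesgue_rV R d.

Lemma Rintegral_odd (D : set 'rV[R]_d) (F : 'rV[R]_d -> R) :
  measurable D -> (forall y, D y -> D (- y)) ->
  measurable_fun setT F -> (forall y, F (- y) = - F y) ->
  mu.-integrable D (EFin \o F) -> \int[mu]_(y in D) F y = 0.
Proof.
move=> mD DN mF FN iF.
have DE : -%R @^-1` D = D.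
  apply/seteqP; split => y /=; last exact: DN.
  by move=> /DN; rewrite opprK.
have FE : (EFin \o F) \o -%R = (-%E \o (EFin \o F)).
  by apply/funext => y /=; rewrite FN.
have e : (\int[mu]_(y in D) (F y)%:E = - \int[mu]_(y in D) (F y)%:E)%E.
  have iN : mu.-integrable (-%R @^-1` D) ((EFin \o F) \o -%R).
    by rewrite DE FE; exact: integrableN.
  have mEF : measurable_fun setT (EFin \o F) by exact/measurable_EFinP.
  have := integral_pushforward measurable_oppr_rV mEF iN mD.
  rewrite DE FE => e; rewrite -[RHS]integralN//; last exact: integrable_add_def.
  rewrite -e; apply: eq_measure_integral => [|? A mA _].
    exact: measurable_oppr_rV.
  by symmetry; exact: lebesgue_rVN.
have /fineK fF := integrable_fin_num mD iF.
rewrite /Rintegral; move: e; rewrite -fF -EFinN => -[]; lra.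
Qed.

Lemma frac_const_ge0 (s : R) : 0 < s -> 0 <= frac_const d s.
Proof.
move=> s0; rewrite /frac_const divr_ge0 ?mulr_ge0 ?powR_ge0//.
rewrite /Gamma ifT; last by rewrite ltr_wpDl// divr_ge0.
by apply: Rintegral_ge0 => t _; rewrite mulr_ge0 ?powR_ge0 ?expR_ge0.
Qed.

Lemma integrable_levy_weight (s e : R) : (0 < d)%N -> 1 / 2 < s < 1 -> 0 < e ->
  mu.-integrable [set y | e < enorm y] (EFin \o levy_weight s).
Proof.
move=> d0 s12 e0; apply: (@integrableS _ _ _ _ [set y | 0 < enorm y]).
- exact: measurable_enorm_gt.
- exact: measurable_enorm_gt.
- by move=> y /=; exact: lt_trans.
apply/integrableP; split.
  by apply/measurable_EFinP/measurable_funTS; exact: measurable_levy_weight.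
under eq_integral do rewrite /= ger0_norm ?levy_weight_ge0//.
exact: levy_weight_integral_lty.
Qed.

(** The part of the integrand that is not absolutely integrable at the origin;
    being odd, it drops out of every truncated integral. *)
Definition odd_part (s : R) (p y : 'rV[R]_d) : R :=
  edot p y * (\1_[set y | ~ 1 <= enorm y] y * enorm y `^ (- (d%:R + 2 * s))).

Lemma measurable_edot (p : 'rV[R]_d) : measurable_fun setT (edot p).
Proof.
apply: measurable_sum => i; apply: measurable_funM => //.
exact: measurable_coord.
Qed.

Lemma measurable_odd_part s p : measurable_fun setT (odd_part s p).
Proof.
apply: measurable_funM; first exact: measurable_edot.
apply: measurable_funM; last exact: measurable_enorm_powR.
apply: measurable_indic; apply: measurableC; exact: measurable_enorm_ge.
Qed.

Lemma integrable_odd_part s p (e : R) : 0 < s -> 0 < e ->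
  mu.-integrable [set y | e < enorm y] (EFin \o odd_part s p).
Proof.
move=> s0 e0.
have mD := @measurable_enorm_gt R d e.
pose M := enorm p * (e `^ (- (d%:R + 2 * s))).
have M0 : 0 <= M by rewrite mulr_ge0 ?enorm_ge0 ?powR_ge0.
apply: (@le_integrable _ _ _ mu _ mD _ (fun y => (M * \1_(cube (- 1) 1) y)%:E)).
- by apply/measurable_EFinP/measurable_funTS; exact: measurable_odd_part.
- move=> y /= ey; rewrite lee_fin [leRHS]ger0_norm ?(mulr_ge0 M0)//.
  rewrite /odd_part !indicE; have [y1|y1] := leP 1 (enorm y).
    rewrite memNset/=; last by rewrite y1.
    by rewrite !(mul0r, mulr0) normr0 (mulr_ge0 M0).
  rewrite mem_set/=; last by apply/negP; rewrite -ltNge.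
  rewrite mem_set/=; last first.
    move=> i /=; rewrite in_itv/= -ler_norml.
    by apply: le_trans (coord_le_enorm _ _) _; exact: ltW.
  rewrite mul1r mulr1 normrM (ger0_norm (powR_ge0 _ _)) /M.
  apply: ler_pM => //; first exact: powR_ge0.
    rewrite ler_norml; apply/andP; split.
      rewrite lerNl -edotNr; apply: le_trans (edot_le _ _) _.
      by rewrite enormN ler_piMr ?enorm_ge0// ltW.
    by apply: le_trans (edot_le _ _) _; rewrite ler_piMr ?enorm_ge0// ltW.
  rewrite !powRN lef_pV2 ?posrE ?powR_gt0//; last exact: lt_trans ey.
  apply: ge0_ler_powR; rewrite ?nnegrE ?enorm_ge0//; last by rewrite ltW.
  - by rewrite addr_ge0// mulr_ge0// ltW.
  - by rewrite ltW.
apply/integrableP; split.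
  apply/measurable_EFinP; apply: measurable_funM => //.
  by apply: measurable_indic; exact: measurable_cube.
under eq_integral do rewrite gee0_abs ?lee_fin ?(mulr_ge0 M0)// EFinM.
rewrite ge0_integralZl_EFin//; last first.
  by apply/measurable_EFinP/measurable_indic; exact: measurable_cube.
rewrite integral_indic//; last exact: measurable_cube.
apply: (@le_lt_trans _ _ (M%:E * mu (cube (- 1) 1))%E).
  by rewrite lee_wpmul2l ?lee_fin// le_measure ?inE//;
    [apply: measurableI => //|]; exact: measurable_cube.
by rewrite lebesgue_rV_cube ?ltry// -EFinM ltry.
Qed.

(** A lower bound on the increments bounds the fractional Laplacian from above.
    The constant contains the integral [A] of [levy_weight] and the absolute
    value [P] of the default returned by [lim] when the truncated integrals
    diverge. *)
Lemma frac_laplacian_le (s : R) : (0 < d)%N -> 1 / 2 < s < 1 ->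
  exists2 C : R, 0 <= C &
  forall (g : 'rV[R]_d -> R) (x p : 'rV[R]_d) (a : R), 0 <= a ->
    measurable_fun setT (fun y => g (x + y)) ->
    (forall y, enorm y < 1 ->
      edot p y - a * enorm y ^+ 2 <= g (x + y) - g x) ->
    (forall y, 1 <= enorm y -> - (a * enorm y) <= g (x + y) - g x) ->
  frac_laplacian s g x <= C * (1 + a).
Proof.
move=> d0 s12; have /andP[s1 s2] := s12; have s0 : 0 < s by lra.
pose A :=
  fine (\int[mu]_(y in [set y | (0 < enorm y)%R]) (levy_weight s y)%:E)%E.
have A0 : 0 <= A.
  by apply/fine_ge0/integral_ge0 => y _; rewrite lee_fin levy_weight_ge0.
pose P := `|(point : R)|.
have P0 : 0 <= P by exact: normr_ge0.
exists (frac_const d s * (A + P)).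
  by rewrite mulr_ge0 ?frac_const_ge0// addr_ge0.
move=> g x p a a0 mg gin gout.
rewrite /frac_laplacian mulNr -mulrN -mulrA ler_wpM2l ?frac_const_ge0//.
rewrite lerNl; set I := (X in lim X).
suff Ige : \forall e \near (0:R)^'+, - (A * a) <=
    \int[mu]_(y in [set y | (e < enorm y)%R])
          ((g (x + y) - g x) * enorm y `^ (- (d%:R + 2 * s))).
  have [cI|/dvgP] := pselect (cvg I).
    apply: (@le_trans _ _ (- (A * a))); last exact: limr_ge.
    by rewrite lerN2 mulrDl mulrDr; nra.
  rewrite /I => ->; rewrite lerNl; apply: (@le_trans _ _ P).
    by rewrite /P -normrN ler_norm.
  by nra.
near=> e.
have e0 : 0 < e by near: e; exact: nbhs_right_gt.
set D := [set y | _].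
have mD : measurable D by exact: measurable_enorm_gt.
have iW : mu.-integrable D (EFin \o levy_weight s).
  exact: integrable_levy_weight.
have iO : mu.-integrable D (EFin \o odd_part s p).
  exact: integrable_odd_part.
have iaW : mu.-integrable D (EFin \o (fun y => a * levy_weight s y)).
  have := integrableZl mD a iW.
  by apply: eq_integrable.
apply: (@Rintegral_ge_of_integrable_minorant _ _ _ mu D
    (fun y => odd_part s p y - a * levy_weight s y)) => //.
- apply: measurable_funTS; apply: measurable_funM.
    exact: measurable_funB.
  exact: measurable_enorm_powR.
- exact: (integrableB mD iO iaW).
- move=> y ey; have y0 : 0 < enorm y by exact: lt_trans ey.
  rewrite /odd_part /levy_weight indicE; have [y1|y1] := leP 1 (enorm y).
    rewrite memNset/=; last by rewrite y1.
    rewrite mul0r mulr0 sub0r mulrA -mulNr ler_wpM2r ?powR_ge0//.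
    rewrite (_ : Num.min _ _ = enorm y); first exact: gout.
    by apply/min_idPr; rewrite expr2 ler_pMr.
  rewrite mem_set/=; last by apply/negP; rewrite -ltNge.
  rewrite mul1r mulrA -mulrBl ler_wpM2r ?powR_ge0//.
  rewrite (_ : Num.min _ _ = enorm y ^+ 2); first exact: gin.
  by apply/min_idPl; rewrite expr2 ger_pMr ?ltW.
- by rewrite oppr_le0 mulr_ge0.
rewrite RintegralB// Rintegral_odd//; last 3 first.
- by move=> y; rewrite /D/= enormN.
- exact: measurable_odd_part.
- move=> y; rewrite /odd_part edotNr enormN mulNr !indicE.
  by congr (- (_ * ((nat_of_bool _)%:R * _))); apply/idP/idP; rewrite !inE/= enormN.
rewrite sub0r lerN2 RintegralZl// mulrC ler_wpM2r// /A /Rintegral.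
rewrite fine_le//.
- exact: integrable_fin_num.
- rewrite ge0_fin_numE; first exact: levy_weight_integral_lty.
  by apply: integral_ge0 => y _; rewrite lee_fin levy_weight_ge0.
apply: ge0_subset_integral => //.
- exact: measurable_enorm_gt.
- by apply/measurable_EFinP/measurable_funTS; exact: measurable_levy_weight.
- by move=> y _; rewrite lee_fin levy_weight_ge0.
- by move=> y /=; exact: lt_trans.
Unshelve. all: by end_near. Qed.

End frac_laplacian_bound.

(** * Concave paraboloids as test functions *)

Section paraboloid.
Context {R : realType} {d : nat}.

Lemma is_derive_quadratic (F : 'rV[R]_d -> R) (x v : 'rV[R]_d) (b c : R) :
  (forall h : R, F (h *: v + x) = F x + h * b + h ^+ 2 * c) ->
  is_derive x v F b.
Proof.
move=> FE.
suff cF : h^-1 *: (F (h *: v + x) - F x) @[h --> 0^'] --> b.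
  by split; [apply/cvg_ex; exists b|exact: cvg_lim].
have : b + h * c @[h --> (0:R)^'] --> b + 0 * c.
  apply: cvgD; first exact: cvg_cst.
  by apply: cvgMr_tmp; exact: nbhs_dnbhs.
rewrite mul0r addr0; apply: cvg_trans; apply: near_eq_cvg.
near=> h.
have h0 : h != 0 by near: h; exact: nbhs_dnbhs_neq.
rewrite FE (_ : _ - F x = h * (b + h * c)); last by ring.
by rewrite /GRing.scale/= mulKf.
Unshelve. all: by end_near. Qed.

Definition paraboloid (z : 'rV[R]_d) (M b : R) (y : 'rV[R]_d) : R :=
  M - b * enorm (y - z) ^+ 2.

Lemma paraboloid_shift z M b x y : paraboloid z M b (x + y) =
  paraboloid z M b x + edot ((- (2 * b)) *: (x - z)) y - b * enorm y ^+ 2.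
Proof.
rewrite /paraboloid (addrAC x y) (enorm_sqrD (x - z)).
have -> : edot ((- (2 * b)) *: (x - z)) y = - (2 * b) * edot (x - z) y.
  by rewrite /edot mulr_sumr; apply: eq_bigr => i _; rewrite mxE mulrA.
ring.
Qed.

Lemma edot_delta (x : 'rV[R]_d) (h : R) i :
  edot x (h *: delta_mx ord0 i) = h * x ord0 i.
Proof.
rewrite /edot (bigD1 i)//= big1 => [|j ji].
  by rewrite !mxE !eqxx mulr1 addr0 mulrC.
by rewrite !mxE (negbTE ji) andbF !mulr0.
Qed.

Lemma paraboloid_continuous z M b : continuous (paraboloid z M b).
Proof.
have caff (N : 'rV[R]_d -> R) :
    continuous N -> continuous (fun y => M - b * N y ^+ 2).
  move=> cN x; apply: (@continuousB R R _ (fun=> M) (fun y => b * N y ^+ 2)).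
    exact: cst_continuous.
  apply: (@continuousM _ _ (fun=> b) (fun y => N y ^+ 2)).
    exact: cst_continuous.
  apply: (@continuous_comp _ _ _ N (fun t : R => t ^+ 2)); first exact: cN.
  exact: exprn_continuous.
apply: (caff (fun y => enorm (y - z))) => x.
apply: (@continuous_comp _ _ _ (fun y : 'rV[R]_d => y - z) (@enorm R d)).
  apply: (@continuousB R 'rV[R]_d _ (fun y => y) (fun=> z)); first exact: cvg_id.
  exact: cst_continuous.
exact: enorm_continuous.
Qed.

Lemma is_derive_paraboloid z M b i x :
  is_derive x (delta_mx ord0 i) (paraboloid z M b)
    (- (2 * b) * (x ord0 i - z ord0 i)).
Proof.
apply: (@is_derive_quadratic _ _ _ _
  (- b * enorm (delta_mx ord0 i : 'rV[R]_d) ^+ 2)) => h.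
rewrite [h *: _ + _]addrC paraboloid_shift edot_delta enormZ exprMn.
by rewrite real_normK ?num_real// !mxE; ring.
Qed.

Lemma partial_paraboloid z M b i :
  partial i (paraboloid z M b) = fun x => - (2 * b) * (x ord0 i - z ord0 i).
Proof.
apply/funext => x; have H := is_derive_paraboloid z M b i x.
by rewrite /partial derive_val.
Qed.

Lemma grad_paraboloid z M b x :
  grad (paraboloid z M b) x = (- (2 * b)) *: (x - z).
Proof. by apply/rowP => i; rewrite !mxE partial_paraboloid. Qed.

Lemma C2_near_paraboloid K z M b : C2_near K (paraboloid z M b).
Proof.
exists setT; split; [exact: openT|by []|].
split; first by move=> x _; exact: paraboloid_continuous.
move=> i; split; first by move=> x _; apply: ex_derive; exact: is_derive_paraboloid.
rewrite partial_paraboloid.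
have D j x : is_derive x (delta_mx ord0 j)
    (fun x : 'rV[R]_d => - (2 * b) * (x ord0 i - z ord0 i))
    (- (2 * b) * (delta_mx ord0 j : 'rV[R]_d) ord0 i).
  by apply: (@is_derive_quadratic _ _ _ _ 0) => h; rewrite !mxE; ring.
split.
  move=> x _; apply: (@continuousM _ _ (fun=> - (2 * b))
    (fun y : 'rV[R]_d => y ord0 i - z ord0 i)); first exact: cst_continuous.
  apply: (@continuousB R R _ (fun y : 'rV[R]_d => y ord0 i) (fun=> z ord0 i)).
    exact: coord_continuous.
  exact: cst_continuous.
move=> j; split; first by move=> x _; apply: ex_derive; exact: D.
rewrite (_ : partial j _ = fun=> - (2 * b) * (delta_mx ord0 j : 'rV[R]_d) ord0 i).
  by split => // x _; exact: cst_continuous.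
by apply/funext => x; have H := D j x; rewrite /partial derive_val.
Qed.

(** The paraboloid is positive only inside the ball of radius [r] about its
    vertex [z], while [u] is nonnegative; so a negative minimum of the
    difference over the cube circumscribed to that ball is a global one. *)
Lemma paraboloid_touches (u : 'rV[R]_d -> R) z (r b : R) :
  continuous u -> (forall x, 0 <= u x) -> 0 < r -> 0 < b ->
  u z < b * r ^+ 2 ->
  exists x, [/\ enorm (x - z) < r, u x < paraboloid z (b * r ^+ 2) b x &
    forall y, u x - paraboloid z (b * r ^+ 2) b x <=
              u y - paraboloid z (b * r ^+ 2) b y].
Proof.
move=> cu u0 r0 b0 uz; set phi := paraboloid _ _ _.
pose K : set 'rV[R]_d :=
  [set v | forall i, `[z ord0 i - r, z ord0 i + r]%classic (v ord0 i)].
have cK : compact K.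
  apply: (@rV_compact _ _ (fun i => `[z ord0 i - r, z ord0 i + r]%classic)).
  by move=> i; exact: segment_compact.
have Kz : K z by move=> i; rewrite /= in_itv/=; apply/andP; split; lra.
have cw : continuous (fun y => u y - phi y).
  move=> y; apply: (@continuousB R R _ u phi); first exact: cu.
  exact: paraboloid_continuous.
have [x xK xmin] : exists2 c, c \in K &
    forall t, t \in K -> u c - phi c <= u t - phi t.
  apply: (EVT_min_rV (f := fun y => u y - phi y)) => //; first by exists z.
  exact: continuous_subspaceT.
have phiz : phi z = b * r ^+ 2.
  by rewrite /phi /paraboloid subrr enorm0 expr0n/= mulr0 subr0.
have xneg : u x - phi x < 0.
  by apply: le_lt_trans (xmin z _) _; [exact: mem_set|rewrite phiz; lra].
have phi_pos y : 0 < phi y -> enorm (y - z) < r.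
  rewrite /phi /paraboloid -mulrBr pmulr_rgt0// subr_gt0.
  by rewrite ltr_pXn2r// ?nnegrE ?enorm_ge0// ltW.
exists x; split.
- by apply: phi_pos; have := u0 x; lra.
- by lra.
- move=> y; have [yr|yr] := ltP (enorm (y - z)) r.
    apply: xmin; apply: mem_set => i; rewrite /= in_itv/=.
    have := le_lt_trans (coord_le_enorm (y - z) i) yr.
    by rewrite !mxE ltr_norml => /andP[? ?]; apply/andP; split; lra.
  have : phi y <= 0.
    by rewrite leNgt; apply/negP => /phi_pos; rewrite ltNge yr.
  by have := u0 y; lra.
Qed.

End paraboloid.

(** * Growth of order 2s is not integrable against the weight *)

Section divergence.
Context {R : realType} {d : nat}.
Let mu := lebesgue_rV R d.

(** On the box [[q, 2q)^d] one has [q <= |y| <= 2 d q], so the integrand is at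
    least a multiple of [q^-d] there; the volume [q^d] compensates exactly, and
    infinitely many disjoint such boxes, with [q] a power of [2], are
    available. *)
Lemma weighted_integral_infinite (s c r0 : R) (u : 'rV[R]_d -> R) :
  (0 < d)%N -> 0 < s -> 0 < c -> measurable_fun setT u ->
  (forall x, r0 <= enorm x -> c * enorm x `^ (2 * s) <= u x) ->
  (\int[mu]_y (`|u y| * (1 + enorm y `^ (d%:R + 2 * s))^-1)%:E = +oo)%E.
Proof.
move=> d0 s0 c0 mu_ ugrow.
set F := (fun y => (_)%:E).
have d1 : 0 < d%:R :> R by rewrite ltr0n.
have F0 y : (0 <= F y)%E.
  by rewrite lee_fin mulr_ge0// invr_ge0 addr_ge0// powR_ge0.
have mF : measurable_fun setT F.
  apply/measurable_EFinP; apply: measurable_funM.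
    exact: (measurableT_comp (@normr_measurable R setT)).
  rewrite (_ : (fun y => _) = (fun y : 'rV[R]_d =>
      (1 + enorm y `^ (d%:R + 2 * s)) `^ (-1))); last first.
    by apply/funext => y; rewrite powR_inv1// addr_ge0// powR_ge0.
  apply: (measurableT_comp (measurable_powR _)).
  by apply: measurable_funD => //; exact: measurable_enorm_powR.
have [k0 k0r] : exists k0, r0 <= 2 ^+ k0.
  have [k /andP[_ k2]] : exists k : nat, 2 ^+ k <= Num.max 1 r0 <= 2 * 2 ^+ k.
    by apply: dyadic_bracket; rewrite le_max lexx.
  by exists k.+1; rewrite exprS; apply: le_trans k2; rewrite le_max lexx orbT.
pose I k : set (measurableTypeR R) :=
  `[2 ^+ (k0 + k), 2 * 2 ^+ (k0 + k)[%classic.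
pose Q k : set 'rV[R]_d := [set v | forall i, I k (v ord0 i)].
have mQ k : measurable (Q k).
  by apply: (@measurable_rV_box _ _ (fun=> I k)) => i; exact: measurable_itv.
have muQ k : mu (Q k) = ((2 ^+ (k0 + k)) ^+ d)%:E.
  rewrite /mu (@lebesgue_rV_box R d (fun=> I k)); last first.
    by move=> i; exact: measurable_itv.
  have -> : lebesgue_measure (I k) = (2 ^+ (k0 + k))%:E.
    rewrite /I lebesgue_measure_itv/= lte_fin ifT -?EFinB.
      by congr EFin; ring.
    by rewrite ltr_pMl ?exprn_gt0// ltr1n.
  by rewrite prodEFin prodr_const card_ord.
pose g := c / 2 * ((2 * d%:R) ^+ d)^-1.
have g0 : 0 < g by rewrite mulr_gt0 ?divr_gt0// invr_gt0 exprn_gt0// mulr_gt0.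
have FQ k y : Q k y -> ((g / (2 ^+ (k0 + k)) ^+ d)%:E <= F y)%E.
  move=> Qy; rewrite /F lee_fin; set q := 2 ^+ (k0 + k).
  have q1 : 1 <= q by rewrite /q exprn_ege1// ler1n.
  have q0 : 0 < q by exact: lt_le_trans q1.
  have yq : q <= enorm y.
    have := Qy (Ordinal d0); rewrite /I /= in_itv/= => /andP[+ _].
    move=> /le_trans; apply; apply: le_trans (coord_le_enorm y (Ordinal d0)).
    exact: ler_norm.
  have yd : enorm y <= 2 * d%:R * q.
    apply: le_trans (enorm_le_sum y) _.
    apply: (@le_trans _ _ (\sum_(i < d) (2 * q))).
      apply: ler_sum => i _; have := Qy i; rewrite /I /= in_itv/= => /andP[y1 y2].
      by rewrite ger0_norm ?ltW// (lt_le_trans q0).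
    by rewrite sumr_const card_ord -[leLHS]mulr_natr; lra.
  have y0 : 0 < enorm y by exact: lt_le_trans yq.
  have y1 : 1 <= enorm y by exact: le_trans yq.
  have uy : c * enorm y `^ (2 * s) <= `|u y|.
    apply: le_trans (ler_norm _); apply: ugrow.
    apply: le_trans yq; apply: le_trans k0r _.
    by rewrite /q exprD ler_peMr ?exprn_ge0// exprn_ege1// ler1n.
  apply: (@le_trans _ _ (c * enorm y `^ (2 * s) *
      (2 * enorm y `^ (d%:R + 2 * s))^-1)).
    rewrite powRD ?(gt_eqF y0) ?implybT// powR_mulrn ?enorm_ge0//.
    have -> : c * enorm y `^ (2 * s) *
        (2 * (enorm y ^+ d * enorm y `^ (2 * s)))^-1 = c / 2 * (enorm y ^+ d)^-1.
      field; rewrite ?gt_eqF ?exprn_gt0 ?powR_gt0//.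
    rewrite /g -[leLHS]mulrA -invfM -exprMn ler_wpM2l ?divr_ge0 ?(ltW c0)//.
    rewrite lef_pV2 ?posrE ?exprn_gt0 ?mulr_gt0//.
    by apply: lerXn2r => //; rewrite nnegrE ?enorm_ge0// !mulr_ge0 ?(ltW q0).
  apply: ler_pM => //.
  - by rewrite mulr_ge0 ?powR_ge0// ltW.
  - by rewrite invr_ge0 mulr_ge0// powR_ge0.
  have p1 : 1 <= enorm y `^ (d%:R + 2 * s).
    by rewrite -[leLHS](powRr0 (enorm y)) ler_powR// addr_ge0// mulr_ge0// ltW.
  by rewrite lef_pV2 ?posrE; lra.
have FQint k : (g%:E <= \int[mu]_(y in Q k) F y)%E.
  apply: (@le_trans _ _ (\int[mu]_(y in Q k) (g / (2 ^+ (k0 + k)) ^+ d)%:E)%E).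
    by rewrite integral_cst// [X in (_ * X)%E](muQ k) -EFinM lee_fin divfK//.
  apply: ge0_le_integral => //.
  - by move=> y _; rewrite lee_fin divr_ge0 ?ltW// !exprn_ge0.
  - exact: measurable_funTS.
  - by move=> y; exact: FQ.
have tQ : trivIset setT Q.
  apply: ltn_trivIset => m n nm; apply/seteqP; split => // y [].
  move=> /(_ (Ordinal d0)); rewrite /I /= in_itv/= => /andP[_ yn].
  move=> /(_ (Ordinal d0)); rewrite /I /= in_itv/= => /andP[ym _].
  have : 2 * 2 ^+ (k0 + n) <= 2 ^+ (k0 + m) :> R.
    by rewrite -exprS -addnS ler_eXn2l ?ltr1n// leq_add2l.
  by move=> /(lt_le_trans yn)/lt_le_trans/(_ ym); rewrite ltxx.
have FN N : ((N%:R * g)%:E <= \int[mu]_y F y)%E.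
  apply: (@le_trans _ _ (\int[mu]_(y in \big[setU/set0]_(k <- iota 0 N) Q k) F y)%E).
    rewrite ge0_integral_bigsetU//; last 3 first.
    - exact: iota_uniq.
    - exact: sub_trivIset tQ.
    - exact: measurable_funTS.
    apply: (@le_trans _ _ (\sum_(k <- iota 0 N) g%:E)%E).
      by rewrite sumEFin big_const_seq count_predT size_iota iter_addr_0 mulr_natl.
    by apply: lee_sum => k _; exact: FQint.
  apply: ge0_subset_integral => //.
  exact: bigsetU_measurable.
apply/eqP; rewrite -leye_eq leNgt; apply/negP => ifin.
have [v vE] : exists v, (\int[mu]_y F y = v%:E)%E.
  exists (fine (\int[mu]_y F y)%E); rewrite fineK//.
  by rewrite ge0_fin_numE// integral_ge0.
have := FN (Num.truncn (v / g)).+1; rewrite vE lee_fin leNgt => /negP; apply.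
by rewrite -ltr_pdivrMr// truncnS_gt.
Qed.

End divergence.

(** * Lower growth of nonnegative supersolutions *)

Section growth.
Context {R : realType} {d : nat}.
Implicit Types (u phi : 'rV[R]_d -> R) (x y z : 'rV[R]_d).

Lemma glue_shift u phi x y : Defs.glue u phi x 1 (x + y) - Defs.glue u phi x 1 x =
  if enorm y < 1 then phi (x + y) - phi x else u (x + y) - u x.
Proof.
by rewrite /Defs.glue (addrC x y) addrK subrr enorm0 ltr01 subrr subr0.
Qed.

Lemma measurable_glue_shift u phi x : continuous u -> continuous phi ->
  measurable_fun setT (fun y => Defs.glue u phi x 1 (x + y)).
Proof.
move=> cu cphi.
have cshift (v : 'rV[R]_d -> R) (a : R) : continuous v ->
    measurable_fun setT (fun y => v (x + y) - a).
  move=> cv; apply: measurable_funB => //; apply: continuous_measurable_rV => y.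
  apply: (@continuous_comp _ _ _ (fun y => x + y) v); last exact: cv.
  apply: (@continuousD R 'rV[R]_d _ (fun=> x) (fun y => y)); last exact: cvg_id.
  exact: cst_continuous.
rewrite /Defs.glue; apply: measurable_fun_ifT; try exact: cshift.
under eq_fun do rewrite addrC addrA addNr add0r.
apply: measurable_fun_ltr => //; exact: measurable_enorm.
Qed.

(** The barrier argument.  If [u z] were below [c r^(2s)] with [r = |z|/2], the
    paraboloid with vertex [z], height [c r^(2s)] and radius [r] would touch
    [u] from below, up to a constant, where [f] exceeds what the other terms
    can reach. *)
Lemma supersolution_lower_growth (s m : R) (H : 'rV[R]_d * 'rV[R]_d -> R)
    (kappa : R) (f : 'rV[R]_d -> R) (kappa0 kappa1 : R) u (lambda : R) :
  (0 < d)%N -> 1 / 2 < s < 1 -> 1 <= m -> 0 < kappa ->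
  (forall x p : 'rV[R]_d, H (x, p) <= kappa * (1 + enorm p `^ m)) ->
  0 < kappa0 -> 0 < kappa1 ->
  (forall x, kappa1 <= enorm x ->
    kappa0 * enorm x `^ (m * (2 * s - 1)) <= f x) ->
  continuous u -> (forall x, 0 <= u x) ->
  viscosity_supersolution s H f u lambda ->
  exists c r0 : R, 0 < c /\
    forall x, r0 <= enorm x -> c * enorm x `^ (2 * s) <= u x.
Proof.
move=> d0 s12 m1 k0 Hle k00 k10 fge cu u0 sup.
have /andP[s1 s2] := s12.
have [C C0 flC] := @frac_laplacian_le R d s d0 s12.
(* K collects the coefficients of c t^m coming from the fractional Laplacian
   and from the Hamiltonian; L collects the terms independent of c and t *)
pose K := 3 * C + kappa * 2 `^ m + 1.
have Kk : 0 <= kappa * 2 `^ m by rewrite mulr_ge0 ?powR_ge0// ltW.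
have K0 : 0 < K by rewrite /K; lra.
pose c := Num.min 1 (kappa0 / (2 * K)).
have c0 : 0 < c by rewrite lt_min ltr01/= divr_gt0// mulr_gt0.
have c1 : c <= 1 by rewrite ge_min lexx.
have cK : K * c <= kappa0 / 2.
  have : c <= kappa0 / (2 * K) by rewrite ge_min lexx orbT.
  by rewrite ler_pdivlMr ?mulr_gt0//; lra.
pose L := C + kappa + `|lambda|.
have L0 : 0 <= L by rewrite /L; have := normr_ge0 lambda; lra.
pose t0 := Num.max 1 (2 * L / kappa0 + 1).
have t01 : 1 <= t0 by rewrite le_max lexx.
have t0L : 2 * L / kappa0 < t0.
  by apply: (@lt_le_trans _ _ (2 * L / kappa0 + 1)); [lra|rewrite le_max lexx orbT].
(* r >= r1 is equivalent to t = r^(2s-1) >= t0 *)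
pose r1 := t0 `^ (2 * s - 1)^-1.
have r1_ge0 : 0 <= r1 by exact: powR_ge0.
exists (c * 2^-1 `^ (2 * s)), (2 * (1 + kappa1 + r1)); split.
  by rewrite mulr_gt0 ?powR_gt0.
move=> z zr.
pose r := 2^-1 * enorm z.
have rz : 1 + kappa1 + r1 <= r by rewrite /r; lra.
have rr1 : 1 <= r by lra.
have r0 : 0 < r by lra.
rewrite -mulrA -powRM ?enorm_ge0// -/r leNgt; apply/negP => uz.
pose t := r `^ (2 * s - 1).
have tt0 : t0 <= t.
  have -> : t0 = r1 `^ (2 * s - 1).
    rewrite /r1 -powRrM mulVf ?powRr1//; first lra.
    by apply/eqP; lra.
  by apply: ge0_ler_powR; rewrite ?nnegrE; lra.
have t1 : 1 <= t by lra.
have r2s : r `^ (2 * s) = r * t.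
  rewrite /t -{2}(powRr1 (ltW r0)) -powRD; last by rewrite (gt_eqF r0) implybT.
  by congr (_ `^ _); ring.
pose b := c * t / r.
have b0 : 0 < b by rewrite divr_gt0// mulr_gt0//; lra.
have br2 : b * r ^+ 2 = c * r `^ (2 * s).
  by rewrite r2s /b; field; lra.
have br : b * r = c * t by rewrite /b divfK ?gt_eqF.
have br0 : 0 < b * r by exact: mulr_gt0.
rewrite -br2 in uz.
have [x [xr ux xmin]] := paraboloid_touches _ _ _ _ cu u0 r0 b0 uz.
set phi := paraboloid _ _ _ in ux xmin.
have phix : phi x <= b * r ^+ 2.
  by rewrite /phi /paraboloid gerBl mulr_ge0 ?exprn_ge0 ?enorm_ge0// ltW.
pose p := (- (2 * b)) *: (x - z).
pose a := 3 * (c * t).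
have phi_shift y : phi (x + y) - phi x = edot p y - b * enorm y ^+ 2.
  by rewrite /phi paraboloid_shift -/p; ring.
have enp : enorm p <= 2 * (c * t).
  rewrite enormZ normrN ger0_norm; last lra.
  rewrite -br -mulrA ler_pM2l// ler_pM2l//; exact: ltW.
have flx : frac_laplacian s (Defs.glue u phi x 1) x <= C * (1 + a).
  apply: (flC _ _ p) => //.
  - by rewrite /a; have : 0 <= c * t by [nra]; lra.
  - apply: measurable_glue_shift => //; exact: paraboloid_continuous.
  - move=> y y1; rewrite glue_shift y1 phi_shift lerB//.
    rewrite ler_wpM2r ?exprn_ge0 ?enorm_ge0//.
    rewrite /a -br; nra.
  - move=> y y1; rewrite glue_shift ltNge y1/=.
    (* within distance r use the touching inequality, whose quadratic term is
       then at most linear; beyond r use only u >= 0 and phi x <= b r^2 *)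
    have [yr|yr] := leP (enorm y) r.
      have := xmin (x + y); have := phi_shift y.
      have : - edot p y <= 2 * b * r * enorm y.
        rewrite -edotNr; apply: le_trans (edot_le _ _) _; rewrite enormN.
        by rewrite ler_wpM2r ?enorm_ge0// -mulrA br.
      have : b * enorm y ^+ 2 <= b * r * enorm y.
        by rewrite expr2 mulrA ler_wpM2r ?enorm_ge0// ler_pM2l.
      by rewrite /a -br; lra.
    have : b * r ^+ 2 <= b * r * enorm y by rewrite expr2 mulrA ler_pM2l// ltW.
    have := u0 (x + y); have : 0 <= b * r * enorm y.
      by rewrite mulr_ge0 ?enorm_ge0// ltW.
    by rewrite /a -br; lra.
have xge : r <= enorm x.
  have := enormD x (z - x); rewrite addrC subrK -opprB enormN.
  by rewrite /r in xr *; lra.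
have := sup x 1 phi ltr01 (C2_near_paraboloid _ _ _ _) (fun y _ => xmin y).
rewrite grad_paraboloid -/p.
have tm : kappa0 * t `^ m <= f x.
  apply: le_trans (fge x _); last lra.
  rewrite ler_pM2l// (mulrC m) powRrM.
  apply: ge0_ler_powR; rewrite ?nnegrE ?powR_ge0//.
    by lra.
  by apply: ge0_ler_powR; rewrite ?nnegrE ?enorm_ge0//; lra.
have Hx : H (x, p) <= kappa * (1 + 2 `^ m * (c * t `^ m)).
  apply: le_trans (Hle _ _) _; rewrite ler_pM2l// lerD2l.
  apply: (@le_trans _ _ ((2 * (c * t)) `^ m)).
    by apply: ge0_ler_powR; rewrite ?nnegrE ?enorm_ge0//; nra.
  rewrite powRM ?ler_pM2l ?powR_gt0 ?mulr_ge0//; [|lra..].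
  rewrite powRM; [|lra..].
  by rewrite ler_wpM2r ?powR_ge0// ge1r_powR// c0.
have tT : t <= t `^ m by rewrite le1r_powR.
set T := t `^ m in tm Hx tT.
have : c * t <= c * T by rewrite ler_pM2l.
have : K * c * T <= kappa0 / 2 * T by rewrite ler_wpM2r//; lra.
have : L < kappa0 / 2 * T.
  move: t0L; rewrite ltr_pdivrMr// => t0L.
  have : t0 * kappa0 <= T * kappa0 by rewrite ler_wpM2r//; lra.
  by lra.
have := ler_norm lambda.
rewrite /K /L /a in flx *.
have : C * (c * t) <= C * (c * T) by rewrite ler_wpM2l// ler_pM2l.
have : 0 < c * T by rewrite mulr_gt0//; lra.
nra.
Qed.

End growth.

Theorem theorem3p8 (R : realType) (d : nat) (hd : (0 < d)%N)
    (s m : R) (hs : 1 / 2 < s < 1) (hm : 1 < m)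
    (H : 'rV[R]_d * 'rV[R]_d -> R) (hH : continuous H)
    (kappa : R) (hkappa : 0 < kappa)
    (hHbounds : forall x p : 'rV[R]_d,
      1 / kappa * enorm p `^ m - kappa <= H (x, p) /\
      H (x, p) <= kappa * (1 + enorm p `^ m))
    (f : 'rV[R]_d -> R) (hf : continuous f)
    (kappa0 kappa1 : R) (hkappa0 : 0 < kappa0) (hkappa1 : 0 < kappa1)
    (hfgrowth : forall x : 'rV[R]_d, kappa1 <= enorm x ->
      kappa0 * enorm x `^ (m * (2 * s - 1)) <= f x) :
  ~ (exists (u : 'rV[R]_d -> R) (lambda : R), admissible s H f u lambda) /\
  lambda_star s H f = +oo%E.
Proof.
have nonex : ~ (exists (u : 'rV[R]_d -> R) (lambda : R), admissible s H f u lambda).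
  move=> [u [lambda [cu [_ uL1] u0 sup]]].
  have [c [r0 [c0 uc]]] := supersolution_lower_growth _ _ _ _ _ _ _ _ _
    hd hs (ltW hm) hkappa
    (fun x p => (hHbounds x p).2) hkappa0 hkappa1 hfgrowth cu u0 sup.
  have s0 : 0 < s by have /andP[] := hs; lra.
  have mu_ := continuous_measurable_rV _ cu.
  by move: uL1; rewrite (weighted_integral_infinite _ _ _ _ hd s0 c0 mu_ uc).
split => //; rewrite /lambda_star (_ : [set _ | _ in _] = set0) ?ereal_inf0//.
by apply/seteqP; split => // e [lambda [u adm] _]; apply: nonex; exists u, lambda.
Qed.
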